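(* Let $n,k$ be integers with $n\ge 2k\ge 6$ and let $Y$ be a graph on $n$ vertices. If $Y$ is $(k-1)$-connected and non-bipartite, and $Y$ is not (isomorphic to) the cycle $C_n$, then the friends-and-strangers graph $\mathsf{FS}(K_{k,n-k},Y)$ is connected.
   Context: All graphs are finite and simple, without loops. $C_n$ is the cycle on $n$ vertices and $K_{k,n-k}$ is the complete bipartite graph with parts of sizes $k$ and $n-k$. ''$(k-1)$-connected'' refers to vertex-connectivity. Friends-and-strangers graph: for graphs $X,Y$ each with $n$ vertices, $\mathsf{FS}(X,Y)$ is the graph whose vertices are all bijections $\sigma:V(X)\to V(Y)$; two bijections $\sigma,\sigma'$ are adjacent if and only if there is an edge $ab\in E(X)$ such that $\sigma(a)\sigma(b)\in E(Y)$, $\sigma(a)=\sigma'(b)$, $\sigma(b)=\sigma'(a)$, and $\sigma(c)=\sigma'(c)$ for all $c\in V(X)\setminus\{a,b\}$. *)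

(* Defs.v *)
From mathcomp Require Import all_boot.

Set Implicit Arguments.
Unset Strict Implicit.
Unset Printing Implicit Defensive.

Record sgraph := SGraph {
  vertex :> finType;
  edge : rel vertex;
  edge_sym : symmetric edge;
  edge_irrefl : irreflexive edge }.

Definition graph_iso (G H : sgraph) : Prop :=
  exists f : G -> H, bijective f /\ forall x y, edge (f x) (f y) = edge x y.

(* The graph with no vertices is not connected. *)
Definition connected (G : sgraph) : Prop :=
  0 < #|G| /\ forall x y : G, connect (@edge G) x y.

Definition bipartite (G : sgraph) : Prop :=
  exists c : G -> bool, forall x y, edge x y -> c x != c y.

Section DeleteVertices.
Variables (G : sgraph) (S : {set G}).

Definition del_edge : rel {x : G | x \notin S} :=
  fun x y => edge (val x) (val y).

Lemma del_edge_sym : symmetric del_edge.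
Proof. by move=> x y; apply: edge_sym. Qed.

Lemma del_edge_irrefl : irreflexive del_edge.
Proof. by move=> x; apply: edge_irrefl. Qed.

Definition del_vertices : sgraph := SGraph del_edge_sym del_edge_irrefl.
End DeleteVertices.

(* The bound [d < #|G|] is part of the definition, so that the complete graph
   on m vertices is exactly (m - 1)-connected. *)
Definition vertex_connected (d : nat) (G : sgraph) : Prop :=
  d < #|G| /\ forall S : {set G}, #|S| < d -> connected (del_vertices S).

Section Cycle.
Variable n : nat.

(* The conjunct [i != j] only matters for n = 1. *)
Definition cycle_edge : rel 'I_n :=
  fun i j => (i != j) && ((j == i.+1 %% n :> nat) || (i == j.+1 %% n :> nat)).

Lemma cycle_edge_sym : symmetric cycle_edge.
Proof. by move=> i j; rewrite /cycle_edge eq_sym orbC. Qed.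

Lemma cycle_edge_irrefl : irreflexive cycle_edge.
Proof. by move=> i; rewrite /cycle_edge eqxx. Qed.

Definition cycle_graph : sgraph := SGraph cycle_edge_sym cycle_edge_irrefl.
End Cycle.

Section CompleteBipartite.
Variables p q : nat.

Definition complete_bipartite_edge : rel ('I_p + 'I_q)%type :=
  fun u v => match u, v with
             | inl _, inr _ | inr _, inl _ => true
             | _, _ => false
             end.

Lemma complete_bipartite_edge_sym : symmetric complete_bipartite_edge.
Proof. by case=> ? [] ?. Qed.

Lemma complete_bipartite_edge_irrefl : irreflexive complete_bipartite_edge.
Proof. by case=> ?. Qed.

Definition complete_bipartite : sgraph :=
  SGraph complete_bipartite_edge_sym complete_bipartite_edge_irrefl.
End CompleteBipartite.

Definition bijectiveb (V W : finType) (f : {ffun V -> W}) : bool :=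
  injectiveb f && [forall w, exists v, f v == w].

Section FriendsAndStrangers.
Variables X Y : sgraph.

Definition FS_vertex : finType := {f : {ffun X -> Y} | bijectiveb f}.

Definition FS_edge : rel FS_vertex := fun s t =>
  let sigma := val s in let sigma' := val t in
  [exists a : X, exists b : X,
    [&& edge a b, edge (sigma a) (sigma b),
        sigma a == sigma' b, sigma b == sigma' a
      & [forall c, (c != a) && (c != b) ==> (sigma c == sigma' c)]]].

Lemma FS_edge_sym : symmetric FS_edge.
Proof.
suff sub s t : FS_edge s t -> FS_edge t s by move=> s t; apply/idP/idP; apply: sub.
case/existsP=> a /existsP[b /and5P[ab sab /eqP ea /eqP eb /forallP fix_c]].
apply/existsP; exists a; apply/existsP; exists b.
rewrite ab -ea -eb edge_sym sab !eqxx /=.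
by apply/forallP=> c; rewrite [val t c == _]eq_sym fix_c.
Qed.

Lemma FS_edge_irrefl : irreflexive FS_edge.
Proof.
move=> s; apply/negbTE/negP.
case/existsP=> a /existsP[b /and5P[_ sab /eqP ea /eqP eb _]].
by move: sab; rewrite ea edge_irrefl.
Qed.

Definition FS : sgraph := SGraph FS_edge_sym FS_edge_irrefl.
End FriendsAndStrangers.

(* Main.v *)
Require Import Defs.
From mathcomp Require Import all_boot all_fingroup.

(* Identify people with positions through a fixed bijection, and colour the
   people according to the two sides of the complete bipartite graph: a move
   swaps two differently coloured tokens lying on adjacent positions. For a
   configuration p, let G be the group of colour-preserving relabelings of the
   tokens that can be achieved by moves; one has to show that G contains every
   colour-preserving permutation.

   (1) Since Y is 2-connected and not a cycle, it has a vertex with three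
   neighbours. If this claw carries two tokens of each colour, six moves exchange
   the two tokens of each colour simultaneously. Since deleting a vertex does not
   disconnect Y, any token can be brought to the claw one step at a time while
   some token of the same colour stays there. Hence each permutation of one
   colour class is induced by an element of G that is even as a permutation of all
   tokens.

   (2) If G contained only even permutations, the parity of the length of a
   simple path of Y would depend only on its end points, and Y would be bipartite.
   Correcting an odd element of G by (1) gives an odd element of G that moves
   tokens of one colour class A only.

   (3) By (1), the elements of G moving only A form a normal subgroup of Sym A,
   and the only normal subgroup of Sym A containing an odd permutation is Sym A
   itself. Together with (1), G is everything. *)

Set Implicit Arguments.
Unset Strict Implicit.
Unset Printing Implicit Defensive.

(** * Normal closure of an odd permutation *)

Section Permutations.
Local Open Scope group_scope.
Variable T : finType.
Implicit Types (A : {set T}) (s t u : {perm T}).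

(** If [s] moves [x], then [s * tperm x (s x)] fixes [x] and every fixed point of [s], so its
    support is smaller. *)
Lemma perm_on_ind A (P : {perm T} -> Prop) :
    P 1 ->
    (forall s x y, perm_on A s -> x \in A -> y \in A -> P s -> P (s * tperm x y)) ->
  forall s, perm_on A s -> P s.
Proof.
move=> P1 PS s; have [n] := ubnP #|[set x | s x != x]|.
elim: n s => // n IHn s; rewrite ltnS => le_sn sA.
have [/forallP s_id|] := boolP [forall x, s x == x].
  by rewrite (_ : s = 1) //; apply/permP=> x; rewrite perm1; apply/eqP.
rewrite negb_forall => /existsP[x sx_x].
have Ax : x \in A by apply: (subsetP sA).
have Asx : s x \in A by rewrite perm_closed.
have tA : perm_on A (tperm x (s x)).
  by apply/subsetP=> y; rewrite inE; case: tpermP => [->|->|]; rewrite ?eqxx.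
rewrite -[s]mulg1 -(tperm2 x (s x)) mulgA.
apply: PS => //; first by rewrite perm_onM.
apply: IHn; last by rewrite perm_onM.
apply: leq_trans le_sn; apply: proper_card; apply/properP; split.
  apply/subsetP=> y; rewrite !inE permM; apply: contra => /eqP sy.
  have yx : y != x by apply: contraNneq sx_x => <-; rewrite sy.
  have ysx : y != s x.
    by apply: contraNneq yx => ysx; rewrite -(inj_eq (@perm_inj _ s)) sy ysx.
  by rewrite sy tpermD // eq_sym.
by exists x; rewrite !inE // permM tpermR eqxx.
Qed.

Variables (A : {set T}) (N : {group {perm T}}) (d : {perm T}).
Hypothesis normA :
  forall s x y, s \in N -> x \in A -> y \in A -> s ^ tperm x y \in N.
Hypotheses (dN : d \in N) (dA : perm_on A d) (d_odd : odd_perm d) (A_gt2 : 2 < #|A|).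

(* Congruence modulo [N] of two transpositions. *)
Let E x y z w := tperm x y * tperm z w \in N.

Let E_sym x y z w : E x y z w -> E z w x y.
Proof. by rewrite /E => xyzw; rewrite -groupV invMg !tpermV. Qed.

Let E_trans x y z w a b : E x y z w -> E z w a b -> E x y a b.
Proof.
by rewrite /E => xyzw zwab; have := groupM xyzw zwab;
  rewrite mulgA -(mulgA _ _ (tperm z w)) tperm2 mulg1.
Qed.

Let E_conj x y z w a b : a \in A -> b \in A -> E x y z w ->
  E (tperm a b x) (tperm a b y) (tperm a b z) (tperm a b w).
Proof. by move=> Aa Ab /(normA)-/(_ _ _ Aa Ab); rewrite conjMg !tpermJ. Qed.

(* The commutator of [s] and [tperm x y] is a product of two transpositions. *)
Let E_comm s x y : s \in N -> x \in A -> y \in A -> E (s x) (s y) x y.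
Proof.
move=> sN Ax Ay; have := groupM (groupVr sN) (normA sN Ax Ay).
by rewrite /conjg tpermV /E -tpermJ /conjg !mulgA.
Qed.

(** Commutators with transpositions suffice if [d] has a cycle of length at least 3, or is an
    involution with a fixed point in [A]. Otherwise [nN] gives an element swapping two pairs, which
    fixes any fifth point of [A]; without such a point [d] would be a product of two transpositions,
    hence even. *)
Let E_adjacent : exists x y z,
  [/\ [&& x \in A, y \in A & z \in A], x != y, x != z, y != z & E x y x z].
Proof.
have dAE x : (d x \in A) = (x \in A) by rewrite perm_closed.
have [/exists_inP[x Ax ddx]|/exists_inPn inv] := boolP [exists x in A, d (d x) != x].
  have dx : d x != x by apply: contraNneq ddx => dx; rewrite !dx.
  have ddx' : d (d x) != d x by rewrite (inj_eq perm_inj).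
  exists (d x), (d (d x)), x; rewrite !dAE Ax; split=> //; first by rewrite eq_sym.
  by have := E_comm dN Ax (etrans (dAE x) Ax); rewrite /E (tpermC x).
have {}inv x : d (d x) = x.
  have [/inv|nAx] := boolP (x \in A); first by rewrite negbK => /eqP.
  by rewrite !(out_perm dA nAx).
have [x dx] : exists x, d x != x.
  apply/existsP; rewrite -negb_forall; apply: contraL d_odd => /forallP d1.
  by rewrite (_ : d = 1) ?odd_perm1 //; apply/permP=> x; rewrite perm1; apply/eqP.
have Ax : x \in A by apply: (subsetP dA).
have fixed s a b c : s \in N -> s a = b -> s c = c -> a \in A -> b \in A ->
    c \in A -> a != b -> exists x y z,
    [/\ [&& x \in A, y \in A & z \in A], x != y, x != z, y != z & E x y x z].
  move=> sN sab scc Aa Ab Ac ab; exists c, b, a; rewrite Aa Ab Ac; split=> //.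
  - by apply: contraNneq ab => cb; rewrite -(inj_eq (@perm_inj _ s)) sab -cb scc.
  - by apply: contraNneq ab => ca; rewrite -sab -ca scc.
  - by rewrite eq_sym.
  by have := E_comm sN Ac Aa; rewrite sab scc.
have [/exists_inP[f Af /eqP df]|/exists_inPn nofix] := boolP [exists f in A, d f == f].
  by apply: (fixed d x (d x) f); rewrite ?dAE // eq_sym.
have [x' Ax' /norP[x'x x'dx]] : exists2 x', x' \in A & ~~ ((x' == x) || (x' == d x)).
  apply/exists_inP; rewrite -[X in is_true X]negbK negb_exists_in.
  apply: contraL A_gt2 => /forall_inP sub; rewrite -leqNgt.
  apply: leq_trans (_ : #|[set x; d x]| <= 2); last by rewrite cards2; case: (_ != _).
  by apply/subset_leq_card/subsetP=> y /sub; rewrite negbK !inE.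
have dx' := nofix _ Ax'.
have nN : tperm (d x) (d x') * tperm x x' \in N by apply: E_comm.
have xdx' : x != d x' by apply: contraNneq x'dx => ->; rewrite inv.
have dxdx' : d x != d x' by rewrite (inj_eq perm_inj) eq_sym.
have [xx' dx'dx dx'x dxx'] : [/\ x != x', d x' != d x, d x' != x & d x != x'].
  by split; rewrite eq_sym.
have [/exists_inP[f Af nf]|/exists_inPn all4] :=
    boolP [exists f in A, f \notin [:: x; d x; x'; d x']].
  apply: (fixed _ x x' f nN) => //.
    by rewrite permM (@tpermD _ _ _ x) ?tpermL.
  by move: nf; rewrite !inE !negb_or => /and4P[? ? ? ?];
    rewrite permM !tpermD // eq_sym.
have dE : d = tperm x (d x) * tperm x' (d x').
  apply/permP=> y; rewrite permM; have [Ay|nAy] := boolP (y \in A).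
    have := all4 _ Ay; rewrite negbK !inE => /or4P[] /eqP->.
    - by rewrite tpermL tpermD.
    - by rewrite tpermR tpermD ?inv.
    - by rewrite (@tpermD _ x (d x)) ?tpermL.
    - by rewrite (@tpermD _ x (d x)) ?tpermR ?inv.
  by rewrite (out_perm dA nAy) !tpermD //; apply: contraNneq nAy => <-; rewrite ?dAE.
by move: d_odd; rewrite dE odd_permM !odd_tperm ![_ == d _]eq_sym dx dx'.
Qed.

(** Conjugation by [tperm c y] replaces [c] by [y] in the congruence of [E_adjacent]; conjugation by
    [tperm a x] then moves the common point from [a] to [x]. *)
Let E_star x : x \in A -> forall y z, y \in A -> z \in A -> y != x -> z != x ->
  E x y x z.
Proof.
have E_refl a b : E a b a b by rewrite /E tperm2 group1.
have [a [b [c [/and3P[Aa Ab Ac] ab ac bc abac]]]] := E_adjacent.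
have star_a y : y \in A -> y != a -> E a b a y.
  move=> Ay ya; have [->|yb] := eqVneq y b; first exact: E_refl.
  by have := E_conj Ac Ay abac;
    rewrite tpermL (@tpermD _ c y a) 1?(@tpermD _ c y b) // eq_sym.
move=> Ax y z Ay Az yx zx; have [xa|xa] := eqVneq x a.
  by rewrite xa in yx zx *; apply: E_trans (E_sym (star_a y Ay yx)) (star_a z Az zx).
have star_x w : w \in A -> w != x -> E x a x w.
  move=> Aw wx; have [->|wa] := eqVneq w a; first exact: E_refl.
  have := E_conj Aa Ax (E_trans (E_sym (star_a x Ax xa)) (star_a w Aw wa)).
  by rewrite tpermR tpermL (@tpermD _ a x w) // eq_sym.
exact: E_trans (E_sym (star_x y Ay yx)) (star_x z Az zx).
Qed.

(** All transpositions of distinct points of [A] are congruent to [t], so [s] or [s * t] lies in [N]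
    according to the parity of [s]. For the odd [d] in [N] this gives [t] in [N]. *)
Lemma odd_normal_closure s : perm_on A s -> s \in N.
Proof.
have [a [b [c [/and3P[Aa Ab Ac] ab ac bc _]]]] := E_adjacent.
pose t := tperm a b.
have Et x y : x \in A -> y \in A -> x != y -> E x y a b.
  move=> Ax Ay xy; have [xa|xa] := eqVneq x a.
    by rewrite xa in xy *; apply: E_star; rewrite // eq_sym.
  have axab : E a x a b by apply: E_star => //; rewrite eq_sym.
  apply: E_trans axab; rewrite /E (tpermC a); apply: E_star => //; by rewrite eq_sym.
have tN s' : perm_on A s' -> (if odd_perm s' then s' * t else s') \in N.
  move: s'; apply: perm_on_ind => [|s' x y _ Ax Ay]; first by rewrite odd_perm1 group1.
  have [<-|xy] := eqVneq x y; first by rewrite tperm1 mulg1.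
  rewrite odd_permM odd_tperm xy addbT; case: odd_perm => /= sN.
    rewrite -[s'](mulgK t) /t tpermV -mulgA groupM //.
    exact: E_sym (Et _ _ Ax Ay xy).
  by rewrite -mulgA groupM //; apply: Et.
have NT : t \in N by have := tN _ dA; rewrite d_odd groupMl.
by move=> /tN; case: ifP => // _; rewrite groupMr.
Qed.

End Permutations.

(** * Configurations and moves *)

Section TokenSwapping.
Local Open Scope group_scope.
Variables (T : finType) (e : rel T).
Implicit Types (col : T -> bool) (p q s : {perm T}) (x y z : T).

(* A configuration is a permutation [p] of [T], with [p x] the token lying on
   the vertex [x]; [col] is a colouring of the tokens. *)
Definition swap_step col : rel {perm T} := fun p q =>
  [exists x, exists y, [&& e x y, col (p x) != col (p y) & q == tperm x y * p]].

Definition reach col := connect (swap_step col).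

Lemma reach_swap col p x y :
  e x y -> col (p x) != col (p y) -> reach col p (tperm x y * p).
Proof.
by move=> xy cxy; apply/connect1/existsP; exists x; apply/existsP; exists y;
  rewrite xy cxy /=.
Qed.

Lemma reach_sym col p q : reach col p q = reach col q p.
Proof.
have sub p' q' : swap_step col p' q' -> swap_step col q' p'.
  case/existsP=> x /existsP[y /and3P[xy cxy /eqP->]].
  apply/existsP; exists x; apply/existsP; exists y.
  by rewrite xy !permM tpermL tpermR eq_sym cxy mulgA tperm2 mul1g /=.
by apply: sym_connect_sym => p' q'; apply/idP/idP; apply: sub.
Qed.

Lemma reach_negb col p q : reach (fun t => ~~ col t) p q = reach col p q.
Proof.
apply: eq_connect => p' q'; apply: eq_existsb => x; apply: eq_existsb => y.
by rewrite (inj_eq negb_inj).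
Qed.

(** Moves multiply on the left and relabelings on the right, so they commute; preserved colours keep
    the moves legal. *)
Lemma reach_relabel col s p q :
  (forall t, col (s t) = col t) -> reach col p q -> reach col (p * s) (q * s).
Proof.
move=> sc /connectP[c]; elim: c p => [|r c IHc] p /=; first by move=> _ ->; apply: connect0.
case/andP=> /existsP[x /existsP[y /and3P[xy cxy /eqP rE]]] /IHc {}IHc /IHc.
apply: connect_trans; rewrite rE -mulgA; apply: reach_swap => //.
by rewrite !permM !sc.
Qed.

(** * The group of achievable relabelings *)

Definition relabelings col p :=
  [set s : {perm T} | [forall t, col (s t) == col t] && reach col p (p * s)].

Lemma relabelingsP col p s :
  reflect ((forall t, col (s t) = col t) /\ reach col p (p * s)) (s \in relabelings col p).
Proof.
rewrite inE; apply: (iffP andP) => -[sc ?]; split=> //.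
  by move=> t; apply/eqP; apply: (forallP sc).
by apply/forallP=> t; apply/eqP.
Qed.

Lemma relabelings_group_set col p : group_set (relabelings col p).
Proof.
apply/group_setP; split=> [|s t /relabelingsP[sc ps] /relabelingsP[tc pt]].
  by apply/relabelingsP; split=> [t|]; rewrite ?perm1 // mulg1; apply: connect0.
apply/relabelingsP; split=> [u|]; first by rewrite permM tc sc.
by apply: connect_trans pt _; rewrite mulgA; apply: reach_relabel.
Qed.
Canonical relabelings_group col p := Group (relabelings_group_set col p).

Lemma relabelings_reach col p q :
  reach col p q -> relabelings col p = relabelings col q.
Proof.
move=> pq; have qp : reach col q p by rewrite reach_sym.
apply/setP=> s; apply/relabelingsP/relabelingsP=> -[sc ps]; split=> //.
  exact: connect_trans qp (connect_trans ps (reach_relabel sc pq)).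
exact: connect_trans pq (connect_trans ps (reach_relabel sc qp)).
Qed.

Lemma relabelings_negb col p : relabelings (fun t => ~~ col t) p = relabelings col p.
Proof.
apply/setP=> s; rewrite !inE reach_negb; congr (_ && _).
by apply: eq_forallb => t; rewrite (inj_eq negb_inj).
Qed.

(* If the second vertex of the path has the colour of the first one, the rest of
   the path is dealt with first; every edge is thus used exactly once, which
   gives the parity of [q]. *)
Lemma slide col p x c :
    path e x c -> uniq (x :: c) -> col (p x) != col (p (last x c)) ->
  exists q, [/\ reach col p q,
    forall z, col (q z) = col (p (tperm x (last x c) z)),
    forall z, z \notin x :: c -> q z = p z
  & odd_perm q = odd_perm p (+) odd (size c)].
Proof.
elim: c x p => [|y c IHc] x p; first by rewrite eqxx.
rewrite [path _ _ _]/= => /andP[xy yc] /andP[xNyc Uyc]; rewrite [last _ _]/=.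
set l := last y c => cxl.
have lyc : l \in y :: c by apply: mem_last.
have xNy : x != y by apply: contraNneq xNyc => ->; rewrite mem_head.
have xNl : x != l by apply: contraNneq xNyc => ->.
have [cxy|cxy] := eqVneq (col (p x)) (col (p y)).
  have [|q [pq qc qid qodd]] := IHc y p yc Uyc; first by rewrite -cxy.
  have qx : q x = p x by apply: qid.
  have qy : col (q y) = col (p l) by rewrite qc tpermL.
  exists (tperm x y * q); split.
  - by apply: connect_trans pq (reach_swap _ _) => //; rewrite qx qy.
  - move=> z; rewrite permM; have [->|zx] := eqVneq z x; first by rewrite !tpermL.
    have [->|zy] := eqVneq z y.
      rewrite tpermR qx; have [->|yl] := eqVneq y l; first by rewrite tpermR.
      by rewrite tpermD // eq_sym.
    rewrite (@tpermD _ x y) 1?eq_sym // qc -/l; have [->|zl] := eqVneq z l.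
      by rewrite !tpermR.
    by rewrite !tpermD // eq_sym.
  - move=> z; rewrite inE negb_or => /andP[zx zyc];
      rewrite permM tpermD 1?eq_sym ?qid //.
    by apply: contraNneq zyc => ->; rewrite mem_head.
  by rewrite odd_permM odd_tperm xNy qodd /=; case: (odd_perm p); case: odd.
have eyl : col (p y) = col (p l) by move: cxy cxl; do 3!case: (col _).
have cyx : col (p x) != col (p y) by [].
pose p1 := tperm x y * p.
have pp1 : reach col p p1 by apply: reach_swap.
have [yl|yl] := eqVneq y l.
  have c0 : c = [::].
    case: c {IHc yc xNyc lyc cxl xNl eyl} @l yl Uyc => //= z c ->.
    by rewrite mem_last.
  by exists p1; rewrite -yl c0 /=; split=> //; [move=> z; rewrite permM | move=> z;
    rewrite !inE negb_or => /andP[zx zy]; rewrite permM tpermD // eq_sym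
    | rewrite odd_permM odd_tperm xNy addbC].
have [|q [pq qc qid qodd]] := IHc y p1 yc Uyc.
  by rewrite !permM tpermR -/l tpermD // -eyl.
exists q; split.
- exact: connect_trans pp1 pq.
- move=> z; rewrite qc permM -/l; have [->|zx] := eqVneq z x.
    by rewrite tpermL (@tpermD _ y l x) 1?eq_sym // tpermL eyl.
  have [->|zl] := eqVneq z l; first by rewrite !tpermR.
  have [->|zy] := eqVneq z y; first by rewrite tpermL !tpermD ?eyl // eq_sym.
  by rewrite !tpermD // eq_sym.
- move=> z; rewrite inE negb_or => /andP[zx zyc];
    rewrite qid // permM tpermD // eq_sym //.
  by apply: contraNneq zyc => ->; rewrite mem_head.
by rewrite qodd odd_permM odd_tperm xNy /=; case: (odd_perm p); case: odd.
Qed.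

Definition linked (M : {set T}) x y :=
  exists c, [/\ path e x c, uniq (x :: c), last x c = y & {subset x :: c <= M}].

(** Sliding along a path in [M] from a vertex wrongly coloured [true] to one wrongly coloured
    [false] exchanges these two colours and keeps all others, so fewer vertices are wrong. Equal
    counts ensure that wrong vertices of both kinds exist together. *)
Lemma recolor col p (M : {set T}) (d : T -> bool) :
    {in M &, forall x y, linked M x y} ->
    #|[set x in M | col (p x)]| = #|[set x in M | d x]| ->
  exists q, [/\ reach col p q, {in M, forall x, col (q x) = d x}
              & forall x, x \notin M -> q x = p x].
Proof.
move=> connM; have [n] := ubnP #|[set x in M | col (p x) && ~~ d x]|.
elim: n p => // n IHn p; rewrite ltnS => lt_n eq_pd.
pose P := [set x in M | col (p x)]; pose D := [set x in M | d x].
have PD : #|P :\: D| = #|D :\: P|.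
  by apply: (@addnI #|P :&: D|); rewrite cardsID setIC cardsID.
have [PD0|[x]] := set_0Vmem (P :\: D).
  exists p; split=> //; first exact: connect0.
  move: PD; rewrite PD0 cards0 => /esym/eqP; rewrite cards_eq0 => /eqP DP0 x Mx.
  have := in_set0 x; rewrite -{1}PD0 !inE Mx /=; have := in_set0 x;
    rewrite -{1}DP0 !inE Mx /=.
  by case: (col _); case: (d _).
rewrite !inE => /andP[nDx /andP[Mx px]]; rewrite Mx /= in nDx.
have [y] : exists y, y \in D :\: P.
  by apply/set0Pn; rewrite -card_gt0 -PD card_gt0; apply/set0Pn; exists x;
    rewrite !inE Mx nDx.
rewrite !inE => /andP[nPy /andP[My dy]]; rewrite My /= in nPy.
have [c [xc Uc lc sub]] := connM _ _ Mx My.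
have [|q [pq qc qid _]] := slide (p := p) (col := col) xc Uc;
    first by rewrite lc px (negbTE nPy).
rewrite lc in qc.
have xy : x != y by apply: contraNneq nPy => <-.
have qidM z : z \notin M -> q z = p z.
  by move=> nMz; apply: qid; apply: contra nMz; apply: sub.
have MT z : (tperm x y z \in M) = (z \in M).
  by case: tpermP => [->|->|//]; rewrite Mx My.
have [||r [qr rd rid]] := IHn q.
- apply: leq_trans lt_n; apply: proper_card; apply/properP; split.
    apply/subsetP=> z; rewrite !inE qc; case: tpermP => [->|->|//];
      first by rewrite (negbTE nPy) andbF.
    by rewrite dy !andbF.
  by exists x; rewrite !inE ?qc ?tpermL Mx ?px ?nDx // (negbTE nPy).
- rewrite -eq_pd -[RHS](card_imset _ (@perm_inj _ (tperm x y))); apply: eq_card => z.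
  rewrite -[z in RHS](tpermK x y) mem_imset; last exact: perm_inj.
  by rewrite !inE qc MT.
exists r; split=> //; first exact: connect_trans pq qr.
by move=> z nMz; rewrite rid ?qidM.
Qed.

End TokenSwapping.

(** * Bringing tokens to a claw *)

Section Gathering.
Local Open Scope group_scope.
Variables (T : finType) (e : rel T) (col : T -> bool).
Hypotheses (e_sym : symmetric e) (e_irr : irreflexive e).
Implicit Types (p q s : {perm T}) (x y z : T).

(* With [x], [a], [b], [d] carrying X, A, B, D (X, A of one colour, B, D of the
   other), the tokens visiting the centre [x] are successively
   X, B, A, D, X, B, A. *)
Lemma claw_double_swap p x a b d :
    [/\ e x a, e x b & e x d] -> uniq [:: x; a; b; d] ->
    col (p x) = col (p a) -> col (p b) = col (p d) -> col (p x) != col (p b) ->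
  reach e col p (tperm x a * tperm b d * p).
Proof.
move=> [xa xb xd]; rewrite /= !inE !negb_or.
case/and4P=> [/and3P[nxa nxb nxd] /andP[nab nad] nbd _] cxa cbd cxb.
have [nax nbx ndx] : [/\ a != x, b != x & d != x] by split; rewrite eq_sym.
have [nba nda ndb] : [/\ b != a, d != a & d != b] by split; rewrite eq_sym.
pose E := (tpermL, tpermR, tpermD nxb nab, tpermD nxd nad, tpermD nxa nba,
  tpermD nxd nbd, tpermD nxa nda, tpermD nxb ndb, tpermD nbx ndx, tpermD nba nda).
pose step q y := reach_swap (e := e) (col := col) (p := q) (x := x) (y := y).
apply: connect_trans (step p b xb cxb) _.
apply: connect_trans (step _ a xa _) _;
  first by rewrite !permM !E -?cxa -?cbd // eq_sym.
apply: connect_trans (step _ d xd _) _;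
  first by rewrite !permM !E -?cxa -?cbd // eq_sym.
apply: connect_trans (step _ b xb _) _;
  first by rewrite !permM !E -?cxa -?cbd // eq_sym.
apply: connect_trans (step _ a xa _) _;
  first by rewrite !permM !E -?cxa -?cbd // eq_sym.
apply: connect_trans (step _ d xd _) _;
  first by rewrite !permM !E -?cxa -?cbd // eq_sym.
rewrite (_ : _ * _ = tperm x a * tperm b d * p); first exact: connect0.
rewrite !mulgA; congr (_ * _); apply/permP=> z; rewrite !permM.
have [->|zx] := eqVneq z x; first by rewrite !E.
have [->|za] := eqVneq z a; first by rewrite !E.
have [->|zb] := eqVneq z b; first by rewrite !E.
have [->|zd] := eqVneq z d; first by rewrite !E.
by rewrite !tpermD // eq_sym.
Qed.

(* Tokens of colour [false] may be permuted as well; evenness is recorded so that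
   an odd relabeling can later be corrected on one colour class. *)
Definition even_swap p x y := exists2 s, s \in relabelings e col p &
  ~~ odd_perm s /\ forall t, col t -> s t = tperm x y t.

Lemma even_swap_refl p x : even_swap p x x.
Proof. by exists 1; rewrite ?group1 // odd_perm1; split=> // t _; rewrite tperm1. Qed.

Lemma even_swap_sym p x y : even_swap p x y -> even_swap p y x.
Proof.
by case=> s sG [s_even sE]; exists s => //; split=> // t; rewrite tpermC; apply: sE.
Qed.

(** On [true] tokens [s * r * s] acts as [tperm y z] conjugated by [tperm x y], that is, as
    [tperm x z]. *)
Lemma even_swap_trans p x y z :
  col x -> col y -> col z -> even_swap p x y -> even_swap p y z -> even_swap p x z.
Proof.
move=> cx cy cz xy yz.
have [->//|nxy] := eqVneq x y; have [<-//|nyz] := eqVneq y z.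
have [->|nxz] := eqVneq x z; first exact: even_swap_refl.
case: xy yz => s sG [s_even sE] [r rG [r_even rE]].
exists (s * r * s); first by rewrite !groupM.
split=> [|t ct]; first by rewrite !odd_permM (negbTE s_even) (negbTE r_even).
have [sc _] := relabelingsP _ _ _ _ sG; have [rc _] := relabelingsP _ _ _ _ rG.
rewrite !permM sE ?rc ?sc // rE ?sc // sE //.
have := tpermJ y z (tperm x y); rewrite tpermR (@tpermD _ x y z) // => <-.
by rewrite /conjg !permM tpermV.
Qed.

Lemma even_swap_reach p q x y : reach e col p q -> even_swap q x y -> even_swap p x y.
Proof. by move=> /relabelings_reach pq [s]; rewrite -pq => sG sE; exists s. Qed.

Variables (c0 : T) (M : {set T}).
Hypotheses (c0M : c0 \in M) (M4 : #|M| = 4).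
Hypothesis leafM : forall x, x \in M -> x != c0 -> e c0 x.

(** [h1] and [h2] are the holes of the claw [M]; since [M] has four vertices, it carries two tokens
    of each colour. *)
Definition balanced p := exists h1 h2, [/\ h1 \in M, h2 \in M, h1 != h2
  & {in M, forall x, col (p x) = (x != h1) && (x != h2)}].

Lemma claw_linked : {in M &, forall x y, linked e M x y}.
Proof.
move=> x y Mx My; have [<-|xy] := eqVneq x y.
  by exists [::]; split=> // z; rewrite inE => /eqP->.
have [xc|xc] := eqVneq x c0.
  rewrite {x}xc in Mx xy *; exists [:: y]; rewrite /= inE xy leafM // 1?eq_sym //.
  by split=> // z; rewrite !inE => /orP[] /eqP->.
have [yc|yc] := eqVneq y c0.
  rewrite {y}yc in My xy *; exists [:: c0]; rewrite /= inE xy e_sym leafM //.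
  by split=> // z; rewrite !inE => /orP[] /eqP->.
exists [:: c0; y]; rewrite /= !inE negb_or xc xy e_sym !leafM // eq_sym yc.
by split=> // z; rewrite !inE => /or3P[] /eqP->.
Qed.

(** The four vertices exhaust [M], so one of them is the centre; the symmetries of the product of
    two disjoint transpositions bring it to the first place, as in [claw_double_swap]. *)
Lemma claw_reach_swap p x y z w :
    {subset [:: x; y; z; w] <= M} -> uniq [:: x; y; z; w] ->
    col (p x) = col (p y) -> col (p z) = col (p w) -> col (p x) != col (p z) ->
  reach e col p (tperm x y * tperm z w * p).
Proof.
move=> sub U cxy czw cxz.
have eqM : [:: x; y; z; w] =i M.
  by apply/subset_cardP; [rewrite (card_uniqP U) M4 | apply/subsetP].
have dbl a b d : uniq [:: c0; a; b; d] -> a \in M -> b \in M -> d \in M ->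
    col (p c0) = col (p a) -> col (p b) = col (p d) -> col (p c0) != col (p b) ->
    reach e col p (tperm c0 a * tperm b d * p).
  move=> U' Ma Mb Md; apply: claw_double_swap => //; move: U'.
  rewrite /= !inE !negb_or => /andP[/and3P[ca cb cd] _].
  by split; apply: leafM => //; rewrite eq_sym.
have [Mx My Mz Mw] : [/\ x \in M, y \in M, z \in M & w \in M].
  by split; apply: sub; rewrite !inE eqxx ?orbT.
have U' : uniq [:: y; x; z; w].
  by rewrite -(perm_uniq (permEl (perm_catCA [:: x] [:: y] [:: z; w]))).
have C : tperm x y * tperm z w = tperm z w * tperm x y.
  move: U; rewrite /= !inE !negb_or => /and4P[/and3P[_ xz xw] /andP[yz yw] _ _].
  by rewrite [RHS]conjgC tpermJ !tpermD.
have czx : col (p z) != col (p x) by rewrite eq_sym.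
have : c0 \in [:: x; y; z; w] by rewrite eqM.
rewrite !inE => /or4P[] /eqP c0E.
- by rewrite -c0E; apply: dbl; rewrite ?c0E.
- rewrite (tpermC x) -c0E; apply: dbl; rewrite ?c0E -?cxy //.
- rewrite C -c0E; apply: dbl; rewrite ?c0E //.
  by rewrite -(rot_uniq 2).
rewrite C (tpermC z) -c0E; apply: dbl; rewrite ?c0E -?czw //.
by rewrite -rev_uniq.
Qed.

Lemma card_claw2 h1 h2 : h1 \in M -> h2 \in M -> h1 != h2 ->
  #|[set x in M | (x != h1) && (x != h2)]| = 2.
Proof.
move=> M1 M2 h12; rewrite (_ : [set x in M | _] = M :\ h1 :\ h2).
  by move: M4; rewrite (cardsD1 h1) M1 (cardsD1 h2) !inE eq_sym h12 M2 => -[].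
by apply/setP=> x; rewrite !inE; case: (x \in M); rewrite /= ?andbF ?andbT // andbC.
Qed.

(** Exchanging the tokens of the two holes at the same time makes the relabeling even and, read on
    positions, turns it into the double swap of [claw_reach_swap]. *)
Lemma claw_even_swap p x y : balanced p -> x \in M -> y \in M ->
  col (p x) -> col (p y) -> even_swap p (p x) (p y).
Proof.
case=> h1 [h2 [M1 M2 h12 cM]] Mx My cx cy.
have [->|xy] := eqVneq x y; first exact: even_swap_refl.
move: (cx) (cy); rewrite !cM // => /andP[x1 x2] /andP[y1 y2].
have c1 : col (p h1) = false by rewrite cM // eqxx.
have c2 : col (p h2) = false by rewrite cM // eqxx andbF.
exists (tperm (p x) (p y) * tperm (p h1) (p h2)).
  apply/relabelingsP; split=> [t|].
    have colE a b u : col a = col b -> col (tperm a b u) = col u.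
      by move=> ab; case: tpermP => // ->.
    by rewrite permM !colE ?cx ?c1.
  rewrite -!tpermJ -conjMg /conjg !mulgA mulgV mul1g.
  apply: claw_reach_swap; rewrite ?cx ?cy ?c1 ?c2 //.
    by move=> t; rewrite !inE => /or4P[] /eqP->.
  by rewrite /= !inE !negb_or xy x1 x2 y1 y2 h12.
rewrite odd_permM !odd_tperm !(inj_eq perm_inj) xy h12; split=> // t ct.
rewrite permM tpermD //; case: tpermP => // [_|_|_ _];
  by [apply: contraTneq cy => <-; rewrite ?c1 ?c2
     | apply: contraTneq cx => <-; rewrite ?c1 ?c2
     | apply: contraTneq ct => <-; rewrite ?c1 ?c2].
Qed.

Hypothesis conn2 : forall w, {in [set~ w] &, forall x y, linked e [set~ w] x y}.

Lemma path_first_hit x c :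
    path e x c -> uniq (x :: c) -> last x c \in M ->
  exists c', [/\ path e x c', uniq (x :: c'), last x c' \in M,
    {subset x :: c' <= x :: c}
    & forall z, z \in x :: c' -> z \in M -> z = last x c'].
Proof.
elim: c x => [|y c IHc] x /= xc Uc lc.
  by exists [::]; split=> // z; rewrite inE => /eqP.
have [Mx|nMx] := boolP (x \in M).
  by exists [::]; split=> // z; rewrite inE => /eqP-> //; rewrite mem_head.
case/andP: xc => xy yc; case/andP: Uc => nx Uc.
have [c' [yc' Uc' lc' sub hit]] := IHc y yc Uc lc.
exists (y :: c'); split=> //=; first by rewrite xy.
- by apply/andP; split=> //; apply: contra nx; apply: sub.
- move=> z; rewrite inE => /orP[/eqP->|/sub]; first by rewrite mem_head.
  by rewrite [z \in x :: _]inE orbC => ->.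
by move=> z; rewrite inE => /orP[/eqP->|]; [rewrite (negbTE nMx) | apply: hit].
Qed.

(** A path to the claw survives the deletion of [w]; it is cut at its first vertex in [M], so that a
    slide along it changes just one vertex of the claw. *)
Lemma path_to_claw w x : x != w ->
  exists c m, [/\ path e x c, uniq (x :: c), last x c = m, m \in M &
    w \notin x :: c /\ forall z, z \in x :: c -> z \in M -> z = m].
Proof.
move=> xw; have [m0 Mm0 m0w] : exists2 m, m \in M & m != w.
  apply/exists_inP; rewrite -[X in is_true X]negbK negb_exists_in.
  have: ~~ (M \subset [set w]).
    by apply: contraTN isT => /subset_leq_card; rewrite M4 cards1.
  apply: contra => /forall_inP sub; apply/subsetP=> m /sub; by rewrite negbK inE.
have [||c [xc Uc lc sub]] := @conn2 w x m0; rewrite ?inE //.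
have [|c' [xc' Uc' lc' sub' hit]] := path_first_hit xc Uc; first by rewrite lc.
exists c', (last x c'); split=> //; split=> //.
by apply/negP=> /sub'/sub; rewrite !inE eqxx.
Qed.

Lemma claw_fourth a b c : exists2 z, z \in M & [/\ z != a, z != b & z != c].
Proof.
have [sub|/subsetPn[z Mz]] := boolP (M \subset [set a; b; c]).
  have := subset_leq_card sub; rewrite M4 leqNgt ltnS.
  by rewrite setUC cardsU1 (leq_add (leq_b1 _) (_ : _ <= 2)) // cards2; case: (_ != _).
by rewrite !inE !negb_or -andbA => /and3P[]; exists z.
Qed.

Lemma balance p h1 h2 : balanced p -> h1 \in M -> h2 \in M -> h1 != h2 ->
  exists q, [/\ reach e col p q, {in M, forall x, col (q x) = (x != h1) && (x != h2)},
    forall x, x \notin M -> q x = p x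
    & forall x, x \in M -> exists2 y, y \in M & q x = p y].
Proof.
case=> k1 [k2 [K1 K2 k12 pM]] M1 M2 h12.
have [|q [pq qM qid]] := recolor (p := p) (col := col)
    (d := fun x => (x != h1) && (x != h2)) claw_linked.
  rewrite card_claw2 // -(card_claw2 K1 K2 k12); apply: eq_card => x.
  by rewrite !inE; have [/pM->|] := boolP (x \in M).
exists q; split=> // x Mx; exists (p^-1 (q x)); last by rewrite permKV.
apply: contraLR Mx => nM; have := qid _ nM; rewrite permKV => /perm_inj xE.
by rewrite xE in nM.
Qed.

(* The token of [v] is brought to the next vertex [u] of a path leading to the
   claw: a hole (a token of colour [false]) is sent to [u] along a path avoiding
   [v], swapped with that token, and sent back from [v] to the claw along a path
   avoiding [u]; another token of colour [true] of the claw is not disturbed. *)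
Lemma gather_step p v u : balanced p -> e v u -> v \notin M -> col (p v) ->
  exists q x y, [/\ reach e col p q, balanced q & q u = p v] /\
    [/\ x \in M, y \in M, q y = p x & col (q y)].
Proof.
move=> bal vu nMv cv.
have [vNu uNv] : v != u /\ u != v.
  by rewrite eq_sym; split; apply: contraTneq vu => ->; rewrite e_irr.
have [c1 [u' [vc1 Uc1 lc1 Mu' [nu1 hit1]]]] := path_to_claw vNu.
have u'Nu : u' != u by apply: contraNneq nu1 => <-; rewrite -lc1 mem_last.
have vNM z : z \in M -> z != v by move=> Mz; apply: contraNneq nMv => <-.
(* Common end of two cases: the token of [v] is on [u], a hole is on [v], and [z] is the only hole
   of the claw. Sliding along [c1] from [v] returns a hole to [u'] without touching [u] or [y]. *)
have finish p2 m z y x : reach e col p p2 -> m \in M -> z \in M -> y \in M -> x \in M ->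
    [/\ z != m, z != u', y != m, y != z & y != u'] -> p2 u = p v -> p2 y = p x ->
    {in M, forall w, w != u' -> col (p2 w) = (w != z)} -> col (p2 u') ->
      ~~ col (p2 v) ->
  exists q x y, [/\ reach e col p q, balanced q & q u = p v] /\
    [/\ x \in M, y \in M, q y = p x & col (q y)].
  move=> pp2 Mm Mz My Mx [zm zu' ym yz yu'] p2u p2y p2M c2u' c2v.
  have [|q [p2q qc qid _]] := slide (p := p2) (col := col) vc1 Uc1.
    by rewrite lc1 c2u' (negbTE c2v).
  rewrite lc1 in qc.
  have qy : q y = p2 y by apply: qid; apply: contraNN yu' => /hit1->.
  exists q, x, y; split; split=> //.
  - exact: connect_trans pp2 p2q.
  - exists z, u'; split=> // w Mw; rewrite qc; have [->|wu'] := eqVneq w u'.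
      by rewrite tpermR (negbTE c2v) andbF.
    by rewrite tpermD ?p2M ?andbT // eq_sym // vNM.
  - by rewrite qid.
  - by rewrite qy.
  by rewrite qy p2M.
have [z Mz []] := claw_fourth u u' u'.
have [Mu|nMu] := boolP (u \in M).
  move=> zu zu' _; have uz : u != z by rewrite eq_sym.
  (* Here [u] is in the claw: one hole is put on [u] itself, the other on [z], away from the end
     [u'] of the return path. *)
  have [p1 [pp1 p1M p1id p1in]] := balance bal Mu Mz uz.
  have [y My [yu yz yu']] := claw_fourth u z u'.
  have [x Mx p1y] := p1in _ My.
  have p1v : p1 v = p v by apply: p1id.
  apply: (finish (tperm v u * p1) u z y x) => //.
  - by apply: connect_trans pp1 (reach_swap vu _); rewrite p1v cv p1M // eqxx.
  - by rewrite permM tpermR.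
  - by rewrite permM tpermD // eq_sym ?vNM.
  - move=> w Mw wu'; rewrite permM; have [->|wu] := eqVneq w u;
      first by rewrite tpermR p1v cv uz.
    have [vw uw] : v != w /\ u != w by split; rewrite eq_sym ?vNM.
    by rewrite tpermD // p1M // wu.
  - have vu' : v != u' by rewrite eq_sym vNM.
    by rewrite permM tpermD 1?(eq_sym u) // p1M // u'Nu eq_sym.
  by rewrite permM tpermL p1M // eqxx.
move=> _ _ _.
have [cu|cu] := boolP (col (p u)); last first.
  have [h1 [h2 [M1 M2 h12 pM]]] := bal.
  have [y My [yh1 yh2 _]] := claw_fourth h1 h2 h2.
  have qid w : w \in M -> (tperm v u * p) w = p w.
    by move=> Mw; rewrite permM tpermD // eq_sym ?vNM //; apply: contraNneq nMu => <-.
  exists (tperm v u * p), y, y; rewrite (qid y My) pM // yh1 yh2; split; split=> //.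
  - by apply: reach_swap; rewrite // cv (negbTE cu).
  - by exists h1, h2; split=> // w Mw; rewrite qid ?pM.
  by rewrite permM tpermR.
(* In the last case [u] carries a [true] token, and a hole placed at [m] is slid to [u] along [c2],
   which avoids [v]. *)
have [c2 [m [uc2 Uc2 lc2 Mm [nv2 hit2]]]] := path_to_claw uNv.
have uNM w : w \in M -> w != u by move=> Mw; apply: contraNneq nMu => <-.
clear z Mz; have [z Mz [zm zu' _]] := claw_fourth m u' u'.
have [y My [ym yz yu']] := claw_fourth m z u'.
have mz : m != z by rewrite eq_sym.
have [p1 [pp1 p1M p1id p1in]] := balance bal Mm Mz mz.
have [x Mx p1y] := p1in _ My.
have [p1v p1u] : p1 v = p v /\ p1 u = p u by split; apply: p1id.
have [|p2 [p12 p2c p2id _]] := slide (p := p1) (col := col) uc2 Uc2.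
  by rewrite lc2 p1u cu p1M // eqxx.
rewrite lc2 in p2c.
have p2v : p2 v = p v by rewrite p2id.
have p2u : ~~ col (p2 u) by rewrite p2c tpermL p1M // eqxx.
have p2M w : w \in M -> col (p2 w) = (w != z).
  move=> Mw; rewrite p2c; have [->|wm] := eqVneq w m; first by rewrite tpermR p1u cu mz.
  have [uw mw] : u != w /\ m != w by split; rewrite eq_sym ?uNM.
  by rewrite tpermD // p1M // wm.
have p3id w : w \in M -> (tperm v u * p2) w = p2 w.
  by move=> Mw; rewrite permM tpermD // eq_sym ?vNM ?uNM.
apply: (finish (tperm v u * p2) m z y x) => //.
- by apply: connect_trans pp1 (connect_trans p12 (reach_swap vu _));
    rewrite p2v cv (negbTE p2u).
- by rewrite permM tpermR.
- by rewrite p3id // p2id //; apply: contraNN ym => /hit2->.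
- by move=> w Mw _; rewrite p3id ?p2M.
- by rewrite p3id ?p2M // eq_sym.
by rewrite permM tpermL.
Qed.

(** After one [gather_step], [p v] lies on the next vertex of the path and [p x'] is still in the
    claw. These two are exchanged by induction, [p x] and [p x'] inside the claw, and
    [even_swap_trans] combines both. *)
Lemma gather p v c : path e v c -> last v c \in M -> balanced p -> col (p v) ->
  forall x, x \in M -> col (p x) -> even_swap p (p x) (p v).
Proof.
elim: c v p => [|u c IHc] v p; first by move=> _ *; apply: claw_even_swap.
have [Mv _ _ bal cv x Mx cx|nMv] := boolP (v \in M); first exact: claw_even_swap.
case/andP=> vu uc lc bal cv x Mx cx.
have [q [x' [y [[pq balq qu] [Mx' My qy cy]]]]] := gather_step bal vu nMv cv.
apply: even_swap_trans (_ : col (p x')) _ _ _ => //; first by rewrite -qy.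
  by apply: claw_even_swap => //; rewrite -qy.
by apply: even_swap_reach pq _; rewrite -qy -qu; apply: IHc => //; rewrite qu.
Qed.

End Gathering.

(** * Reachability of all configurations *)

Section Connectedness.
Local Open Scope group_scope.
Variables (T : finType) (e : rel T).
Hypotheses (e_sym : symmetric e) (e_irr : irreflexive e).
Hypothesis conn : {in [set: T] &, forall x y, linked e [set: T] x y}.
Hypothesis conn2 : forall w, {in [set~ w] &, forall x y, linked e [set~ w] x y}.
Implicit Types (col : T -> bool) (p q s : {perm T}) (x y z : T).

Lemma card_colour col p : #|[set x | col (p x)]| = #|[set t | col t]|.
Proof.
rewrite -[RHS](card_preimset _ (@perm_inj _ p)); apply: eq_card => x; by rewrite !inE.
Qed.

Lemma exists_set_of_card (A : {set T}) k : k <= #|A| ->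
  exists2 B : {set T}, B \subset A & #|B| = k.
Proof.
case/card_geqP=> c [Uc cE sub]; exists [set x in c].
  by apply/subsetP=> x; rewrite inE => /sub.
by rewrite cardsE (card_uniqP Uc).
Qed.

Variables (c0 : T) (M : {set T}).
Hypotheses (c0M : c0 \in M) (M4 : #|M| = 4).
Hypothesis leafM : forall x, x \in M -> x != c0 -> e c0 x.

Lemma reach_balanced col p : 2 <= #|[set t | col t]| -> 2 <= #|[set t | ~~ col t]| ->
  exists2 q, reach e col p q & balanced col M q.
Proof.
move=> col2 ncol2.
have [H HM H2] : exists2 H : {set T}, H \subset M & #|H| = 2.
  by apply: exists_set_of_card; rewrite M4.
(* [B] receives the [true] tokens left over after two are put on [H]; it fits outside [M] because at
   least two tokens are [false]. *)
have [B BM B2] : exists2 B : {set T}, B \subset ~: M & #|B| = #|[set t | col t]| - 2.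
  apply: exists_set_of_card; rewrite [leqRHS]cardsCs setCK M4 -(cardsC [set t | col t]).
  rewrite (_ : ~: _ = [set t | ~~ col t]); last by apply/setP=> t; rewrite !inE.
  move: #|[set t | col t]| #|[set t | ~~ col t]| col2 ncol2 => [|[|K]] [|[|L]] // _ _.
  by rewrite !addSn !addnS !subSS !subn0 leq_addr.
have HB0 : [disjoint H & B].
  by rewrite disjoint_sym disjoints_subset (subset_trans BM) ?setCS.
have [|q [pq qE _]] := recolor (p := p) (col := col) (d := fun x => x \in H :|: B) conn.
  transitivity #|[set x | col (p x)]|; first by apply: eq_card => x; rewrite !inE.
  rewrite card_colour; transitivity #|H :|: B|; last by apply: eq_card => x;
    rewrite !inE.
  by rewrite cardsU disjoint_setI0 // cards0 subn0 H2 B2 subnKC.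
exists q => //.
have : #|M :\: H| == 2 by rewrite cardsD (setIidPr HM) H2 M4.
case/cards2P=> h1 [h2 [h12 /setP MH]]; exists h1, h2.
have [M1 M2] : h1 \in M /\ h2 \in M.
  by split; apply: (subsetP (subsetDl M H)); rewrite MH !inE eqxx ?orbT.
split=> // x Mx; rewrite qE ?inE //; have := MH x; rewrite !inE Mx andbT.
have -> : x \in B = false by apply: contraTF Mx => /(subsetP BM); rewrite inE.
by rewrite orbF -negb_or => <-; rewrite negbK.
Qed.

(** In a balanced configuration each [true] token can be exchanged with one fixed token [q z] of the
    claw. *)
Lemma all_even_swap col p x y : 2 <= #|[set t | col t]| -> 2 <= #|[set t | ~~ col t]| ->
  col x -> col y -> even_swap e col p x y.
Proof.
move=> col2 ncol2 cx cy; have [q pq bal] := reach_balanced p col2 ncol2.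
apply: even_swap_reach pq _.
have [h1 [h2 [M1 M2 h12 qM]]] := bal.
have [z Mz [zh1 zh2 _]] := claw_fourth M4 h1 h2 h2.
have cz : col (q z) by rewrite qM // zh1.
have toz t : col t -> even_swap e col q (q z) t.
  move=> ct; rewrite -[t](permKV q).
  have [||c [xc _ lc _]] := @conn (q^-1 t) c0; rewrite ?inE //.
  by apply: (gather e_sym e_irr c0M M4 leafM conn2 xc); rewrite ?lc ?permKV.
by apply: even_swap_trans (even_swap_sym (toz _ cx)) (toz _ cy).
Qed.

(** The restriction of [s] to the [true] tokens is a product of transpositions, each induced by an
    even relabeling by [all_even_swap]. *)
Lemma even_relabeling col p s : 2 <= #|[set t | col t]| -> 2 <= #|[set t | ~~ col t]| ->
  (forall t, col (s t) = col t) ->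
  exists2 r, r \in relabelings e col p & ~~ odd_perm r /\ forall t, col t -> r t = s t.
Proof.
move=> col2 ncol2 sc; pose A := [set t | col t].
have sA : s \in 'N(A | 'P).
  by apply/astabsP=> t; rewrite !inE /= apermE sc.
suff [r rG [r_even rE]] : exists2 r, r \in relabelings e col p &
    ~~ odd_perm r /\ forall t, col t -> r t = restr_perm A s t.
  by exists r => //; split=> // t ct; rewrite rE // restr_permE // inE.
move: (restr_perm A s) (restr_perm_on A s); apply: perm_on_ind => [|u x y uA].
  by exists 1; rewrite ?group1 ?odd_perm1.
rewrite !inE => cx cy [r rG [r_even rE]].
have [w wG [w_even wE]] := all_even_swap p col2 ncol2 cx cy.
exists (r * w); first by rewrite groupM.
split=> [|t ct]; first by rewrite odd_permM (negbTE r_even) (negbTE w_even).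
have [rc _] := relabelingsP _ _ _ _ rG.
by rewrite !permM wE ?rc // rE.
Qed.

(* If all relabelings were even, the length of a simple path from [x] to [y]
   would have a parity depending on [x] and [y] only, by [slide]; the parity of
   the paths from a root is then a proper 2-colouring. *)
Lemma odd_relabeling col p : 0 < #|[set t | col t]| -> 0 < #|[set t | ~~ col t]| ->
    ~ (exists c : T -> bool, forall x y, e x y -> c x != c y) ->
  exists2 s, s \in relabelings e col p & odd_perm s.
Proof.
move=> col0 ncol0 nbip; apply/exists_inP; apply: contra_notT nbip;
  rewrite negb_exists_in => /forall_inP ev.
(* Two reachable configurations with equal colours differ by the relabeling [q^-1 * r], which is
   even by assumption. *)
have parity q r : reach e col p q -> reach e col q r ->
    (forall x, col (r x) = col (q x)) -> odd_perm r = odd_perm q.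
  move=> pq qr cqr; have := ev (q^-1 * r);
    rewrite (relabelings_reach pq) odd_permM odd_permV.
  case: (odd_perm r) (odd_perm q) => [] [] //= H; exfalso; apply: notF; apply: H;
    apply/relabelingsP; split; rewrite ?mulKVg // => t; by rewrite permM cqr permKV.
have path_parity x c c' : path e x c -> path e x c' ->
    uniq (x :: c) -> uniq (x :: c') ->
    last x c = last x c' -> odd (size c) = odd (size c').
  move=> xc xc' Uc Uc' lcc.
  have [lx|lx] := eqVneq (last x c) x.
    have nil b : uniq (x :: b) -> last x b = x -> b = [::].
      by case: b => //= y b /andP[+ _] lb; rewrite -lb mem_last.
    by rewrite (nil c) // (nil c') // -lcc.
  (* A slide along the path needs ends of different colours; if they agree, a first slide brings the
     other colour to the last vertex. *)
  have [q pq cq] : exists2 q, reach e col p q & col (q x) != col (q (last x c)).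
    have [cpx|cpx] := eqVneq (col (p x)) (col (p (last x c)));
        last by exists p => //; apply: connect0.
    have [z cz] : exists z, col (p z) != col (p x).
      have [/card_gt0P[t]] : 0 < #|[set t | col t != col (p x)]|.
        by case: (col (p x)); [move: ncol0 | move: col0]; congr (0 < _);
          apply: eq_card => t; rewrite !inE; case: (col t).
      by rewrite inE => ct; exists (p^-1 t); rewrite permKV.
    have [||b [zb Ub lb _]] := @conn z (last x c); rewrite ?inE //.
    have [|q [pq qc _ _]] := slide (p := p) (col := col) zb Ub;
        first by rewrite lb -cpx.
    have zx : z != x by apply: contraNneq cz => ->.
    by exists q; rewrite // !qc lb tpermR tpermD // eq_sym.
  have [q1 [qq1 q1c _ q1o]] := slide xc Uc cq.
  rewrite lcc in cq; have [q2 [qq2 q2c _ q2o]] := slide xc' Uc' cq.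
  have := parity q1 q2 (connect_trans pq qq1); rewrite q1o q2o => /(_ _ _)/addbI<- //.
    by apply: connect_trans qq2; rewrite -/(reach e col q1 q) reach_sym.
  by move=> z; rewrite q1c q2c lcc.
have pth v : {c | [&& path e c0 c, uniq (c0 :: c) & last c0 c == v]}.
  apply: sigW; have [||c [? ? /eqP ? _]] := @conn c0 v; rewrite ?inE //.
  by exists c; apply/and3P.
exists (fun v => odd (size (sval (pth v)))) => u v uv.
have extend x y b : e x y -> path e c0 b -> uniq (c0 :: b) -> last c0 b = x ->
    y \notin c0 :: b -> odd (size (sval (pth x))) != odd (size (sval (pth y))).
  move=> xy pb Ub lb ny; case: (pth x) => /= c /and3P[pc Uc /eqP lc].
  case: (pth y) => /= c' /and3P[pc' Uc' /eqP lc'].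
  rewrite (path_parity _ _ _ pc pb) ?lc // (path_parity _ _ (rcons b y) pc') //.
  - by rewrite size_rcons /=; case: odd.
  - by rewrite rcons_path pb lb.
  - by rewrite -rcons_cons rcons_uniq ny.
  by rewrite last_rcons.
have [c /and3P[pc Uc /eqP lc]] := pth u.
(* If the path to [u] misses [v], it extends to [v]; otherwise its initial part up to [v] misses [u]
   and extends to [u]. *)
have [vP|] := boolP (v \in c0 :: c); last exact: extend uv pc Uc lc.
case/splitPl: vP pc Uc lc => c1 c2 lc1.
rewrite cat_path last_cat lc1 -cat_cons cat_uniq =>
  /andP[pc1 _] /and3P[Uc1 /hasPn dis _] lc2.
rewrite eq_sym; apply: extend pc1 Uc1 lc1 _; first by rewrite e_sym.
apply: dis; have := mem_last v c2; rewrite lc2 inE => /orP[/eqP uvE|//].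
by rewrite uvE e_irr in uv.
Qed.

Lemma all_relabelings col p s :
    2 <= #|[set t | col t]| -> 2 < #|[set t | ~~ col t]| ->
    ~ (exists c : T -> bool, forall x y, e x y -> c x != c y) ->
  (forall t, col (s t) = col t) -> s \in relabelings e col p.
Proof.
move=> col2 ncol3 nbip sc; have ncol2 := ltnW ncol3.
have lift_true r := @even_relabeling col p r col2 ncol2.
(* The same lifting for the other class, by exchanging the colours. *)
have lift_false (r : {perm T}) : (forall t, col (r t) = col t) ->
    exists2 w, w \in relabelings e col p & forall t, ~~ col t -> w t = r t.
  move=> rc; case: (@even_relabeling (fun t => ~~ col t) p r) => //.
  - rewrite (_ : [set t | _] = [set t | col t]) //; by apply/setP=> t;
      rewrite !inE negbK.
  - by move=> t; rewrite rc.
  by move=> w; rewrite relabelings_negb => wG [_ wE]; exists w.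
pose A := [set t | ~~ col t].
pose N := (relabelings_group e col p :&: Sym_group A)%G.
have fixN (r : {perm T}) : (forall t, col t -> r t = t) -> perm_on A r.
  by move=> r1; apply/subsetP=> t; rewrite !inE; apply: contra => /r1->.
have [g gG g_odd] := odd_relabeling p (ltnW col2) (ltnW ncol2) nbip.
have [gc _] := relabelingsP _ _ _ _ gG.
have [r rG [r_even rE]] := lift_true g gc.
(* [r] is even and agrees with [g] on the [true] tokens, so [g * r^-1] is odd and moves only [A]. *)
have dA : perm_on A (g * r^-1).
  by apply: fixN => t ct; rewrite permM -rE // permK.
have normN (u : {perm T}) x y : u \in N -> x \in A -> y \in A -> u ^ tperm x y \in N.
  rewrite inE [u \in Sym _]inE => /andP[uG uA] Ax Ay.
  have txyA : tperm x y \in Sym A.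
    rewrite inE; apply/subsetP=> t; rewrite inE.
    by case: tpermP => [->|->|]; rewrite ?Ax ?Ay ?eqxx.
  have uxyA : u ^ tperm x y \in Sym A by rewrite groupJ // inE.
  rewrite inE uxyA andbT.
  have [t|w wG wE] := lift_false (tperm x y).
    by move: Ax Ay; rewrite !inE; case: tpermP => // -> /negbTE-> /negbTE->.
  have [wc _] := relabelingsP _ _ _ _ wG.
  (* [u] moves only [A], where [w] acts as [tperm x y], so the two conjugates coincide. *)
  suff -> : u ^ tperm x y = u ^ w by rewrite groupJ.
  apply/permP=> t; rewrite -[t](permKV w); move: (w^-1 t) => {}t; rewrite permJ.
  have [At|nAt] := boolP (t \in A).
    rewrite wE; last by rewrite inE in At.
    rewrite permJ wE //; have : u t \in A by rewrite perm_closed.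
    by rewrite inE.
  rewrite (out_perm uA nAt); rewrite inE in uxyA; apply: (out_perm uxyA).
  by rewrite inE wc; rewrite inE in nAt.
have AN (u : {perm T}) : perm_on A u -> u \in N.
  apply: (odd_normal_closure normN _ dA _ ncol3).
    by rewrite inE groupM ?groupV //= inE.
  by rewrite odd_permM odd_permV g_odd (negbTE r_even).
have [w wG [_ wE]] := lift_true s sc.
have [wc _] := relabelingsP _ _ _ _ wG.
have: w^-1 * s \in N.
  apply: AN; apply: fixN => t ct; rewrite permM.
  have cwt : col (w^-1 t) by rewrite -wc permKV.
  by rewrite -wE // permKV.
by rewrite inE => /andP[+ _]; rewrite groupMl ?groupV.
Qed.

(** [recolor] gives [r] with the colours of [q]; what remains is the colour-preserving relabeling
    [r^-1 * q] of [r]. *)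
Lemma all_reach col p q :
    2 <= #|[set t | col t]| -> 2 < #|[set t | ~~ col t]| ->
    ~ (exists c : T -> bool, forall x y, e x y -> c x != c y) ->
  reach e col p q.
Proof.
move=> col2 ncol3 nbip.
have [|r [pr rE _]] := recolor (p := p) (col := col) (d := fun x => col (q x)) conn.
  transitivity #|[set x | col (p x)]|; first by apply: eq_card => x; rewrite !inE.
  rewrite card_colour -(card_colour _ q); by apply: eq_card => x; rewrite !inE.
apply: connect_trans pr _; rewrite -/(reach _ _ _ _) -[q](mulKVg r).
have [|//] :=
  relabelingsP _ _ _ _ (all_relabelings (s := r^-1 * q) r col2 ncol3 nbip _).
by move=> t; rewrite permM -rE ?inE // permKV.
Qed.

End Connectedness.

(** * From graphs to configurations *)

Lemma connected_linked (Y : sgraph) (S : {set Y}) :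
  connected (del_vertices S) -> {in ~: S &, forall x y, linked (@edge Y) (~: S) x y}.
Proof.
move=> [_ connS] x y; rewrite !inE => Sx Sy.
have /connectP[c xc yE] := connS (Sub x Sx) (Sub y Sy).
case: (shortenP xc) yE => {}c {}xc Uc _ yE; exists (map val c); split.
- by rewrite -[x]/(val (Sub x Sx : {x | x \notin S})) path_map.
- by rewrite -[x]/(val (Sub x Sx : {x | x \notin S})) -map_cons (map_inj_uniq val_inj).
- by rewrite -[x]/(val (Sub x Sx : {x | x \notin S})) last_map -yE.
move=> z; rewrite -[x]/(val (Sub x Sx : {x | x \notin S})) -map_cons.
by case/mapP=> w _ ->; rewrite inE; apply: (valP (w : {x | x \notin S})).
Qed.

(** * Connected graphs of maximum degree two *)

Lemma next_nth_index (T : eqType) (c : seq T) x y : uniq c -> x \in c -> y \in c ->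
  (next c x == y) = (index y c == (index x c).+1 %% size c).
Proof.
case: c => // r s; set c := r :: s => Uc cx cy.
have ix : index x c < size c by rewrite index_mem.
have -> : next c x = nth r c ((index x c).+1 %% size c).
  (* [next_nth] reads the entry in [s], so the last element of [c] falls back on the default [r],
     the head of [c]. *)
  rewrite next_nth cx; move: ix; rewrite leq_eqVlt => /orP[/eqP i_last|i_lt].
    by rewrite i_last modnn /= nth_default //; move: i_last => [->].
  by rewrite modn_small.
by rewrite -[in LHS](nth_index r cy) nth_uniq ?index_mem ?ltn_pmod // eq_sym.
Qed.

(** A vertex [r] has a neighbour [a] and, as it stays linked to a third vertex without [a], a second
    neighbour [b]. A path from [a] to [b] avoiding [r] closes up to a cycle [C]; by the degree bound
    no edge leaves [C], so [C] covers [Y]. *)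
Lemma max_degree2_cycle (Y : sgraph) (n : nat) :
    #|Y| = n -> 2 < n ->
    {in [set: Y] &, forall x y, linked (@edge Y) [set: Y] x y} ->
    (forall w : Y, {in [set~ w] &, forall x y, linked (@edge Y) [set~ w] x y}) ->
    (forall x : Y, #|[set y | edge x y]| <= 2) ->
  graph_iso Y (cycle_graph n).
Proof.
move=> Yn n_gt2 conn conn2 deg2.
have [r _] : exists r : Y, r \in [set: Y].
  by apply/card_gt0P; rewrite cardsT Yn; case: (n) n_gt2.
have third (A : {set Y}) : #|A| <= 2 -> exists x, x \notin A.
  move=> A2; apply/existsP; rewrite -negb_forall; apply: contraTN n_gt2 => /forallP AT.
  by rewrite -leqNgt -Yn (leq_trans _ A2) // -cardsT subset_leq_card //;
    apply/subsetP=> x _.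
have first_step y (M : {set Y}) : linked (@edge Y) M r y -> y != r ->
  exists2 a, edge r a & a \in M.
  case=> [[|a c]] [/= rc _ lc sub] yr; first by rewrite -lc eqxx in yr.
  by exists a; [case/andP: rc | apply: sub; rewrite !inE eqxx orbT].
have [|y yr] := third [set r]; first by rewrite cards1.
rewrite inE in yr.
have [||a ra _] := first_step y _ (conn r y _ _) yr; rewrite ?inE //.
have ar : a != r by apply: contraTneq ra => ->; rewrite edge_irrefl.
have [|z] := third [set r; a]; first by rewrite cards2; case: (_ != _).
rewrite !inE negb_or => /andP[zr za].
have ra' : r != a by rewrite eq_sym.
have [||b rb ba] := first_step z _ (conn2 a r z _ _) zr; rewrite ?inE //.
rewrite !inE in ba.
have br : b != r by apply: contraTneq rb => ->; rewrite edge_irrefl.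
have [||c [ac Uc lc sub]] := conn2 r a b; rewrite ?inE //.
pose C := r :: a :: c.
have UC : uniq C by rewrite /C cons_uniq Uc andbT; apply/negP=> /sub; rewrite !inE eqxx.
have cycC : path.cycle (@edge Y) C by rewrite /= ra rcons_path ac lc edge_sym.
have C_gt2 : 2 < size C by rewrite /C; case: (c) lc ba => [|? ?] //= ->; rewrite eqxx.
have rC : r \in C by apply: mem_head.
(* With more than two vertices, successor and predecessor on [C] differ, hence are all the
   neighbours allowed by [deg2]. *)
clearbody C; have next2 x : x \in C -> next C (next C x) != x.
  move=> Cx; rewrite next_nth_index ?mem_next //.
  have /eqP-> : index (next C x) C == (index x C).+1 %% size C.
    by rewrite -next_nth_index ?mem_next.
  have i_lt : index x C < size C by rewrite index_mem.
  rewrite -addn1 modnDml addn1; have [lt2|gt2|eq2] := ltngtP (index x C).+2 (size C).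
  - by rewrite modn_small // neq_ltn ltnS leqnSn.
  - have i_last : (index x C).+1 = size C by apply/eqP; rewrite eqn_leq i_lt.
    rewrite i_last -addn1 modnDl modn_small ?(ltnW C_gt2) //.
    by rewrite -i_last ltnS in C_gt2; rewrite neq_ltn C_gt2 orbT.
  by rewrite eq2 modnn neq_ltn -eq2 !ltnS in C_gt2 *; rewrite C_gt2.
have nbrs x t : x \in C -> edge x t = (t == next C x) || (x == next C t).
  move=> Cx; apply/idP/orP=> [xt|[/eqP->|/eqP xE]]; last 1 first.
  - have Ct : t \in C by rewrite -mem_next -xE.
    by rewrite xE edge_sym next_cycle.
  - have sub2 : [set next C x; prev C x] \subset [set u | edge x u].
      apply/subsetP=> u; rewrite !inE => /orP[] /eqP->; first exact: next_cycle.
      by rewrite edge_sym prev_cycle.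
    have : [set next C x; prev C x] == [set u | edge x u].
      rewrite eqEcard sub2 (leq_trans (deg2 x)) // cards2.
      suff -> : next C x != prev C x by [].
      by apply: contraNneq (next2 x Cx) => ->; rewrite next_prev.
    move=> /eqP/setP/(_ t); rewrite !inE xt => /orP[] /eqP->; first by left.
    by right; rewrite next_prev.
  exact: next_cycle.
have CT x : x \in C.
  have [||b' [+ _ <- _]] := conn r x; rewrite ?inE //.
  move: rC; elim: b' (r) => //= t b' IHb u Cu /andP[ut]; apply: IHb.
  move: ut; rewrite nbrs // => /orP[/eqP->|/eqP uE]; first by rewrite mem_next.
  by rewrite -mem_next -uE.
have sC : size C = n by rewrite -Yn -(card_uniqP UC); apply: eq_card => x; rewrite CT.
have iC x : index x C < n by rewrite -sC index_mem.
exists (fun x => Ordinal (iC x) : cycle_graph n); split.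
  apply: inj_card_bij => [x y' [ixy]|]; last by rewrite card_ord Yn.
  by rewrite -(nth_index r (CT x)) ixy nth_index.
move=> x t; rewrite /= /cycle_edge -(inj_eq val_inj) /=.
have [<-|xt] := eqVneq x t; first by rewrite eqxx edge_irrefl.
rewrite (inj_in_eq (@index_inj _ r C)) ?CT // xt nbrs //.
by rewrite ![_ == next C _]eq_sym !next_nth_index // sC.
Qed.

(** * Configurations as vertices of the friends-and-strangers graph *)

Section Transfer.
Local Open Scope group_scope.
Variables (k l : nat) (Y : sgraph).
Local Notation X := (complete_bipartite k l).
Variables (f : Y -> X) (g : X -> Y).
Hypotheses (fK : cancel f g) (gK : cancel g f).

Definition left_token (t : Y) : bool := if f t is inl _ then true else false.

Lemma card_left_token : #|[set t | left_token t]| = k.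
Proof.
rewrite -[RHS]card_ord -cardsT -(card_imset _ (@inl_inj 'I_k 'I_l)).
rewrite -(@on_card_preimset _ _ f); last by exists g => x _.
apply: eq_card => t; rewrite !inE /left_token; case: (f t) => i.
  by rewrite imset_f.
by symmetry; apply/negbTE/imsetP=> -[].
Qed.

Lemma card_right_token : #|[set t | ~~ left_token t]| = l.
Proof.
rewrite -[RHS]card_ord -cardsT -(card_imset _ (@inr_inj 'I_k 'I_l)).
rewrite -(@on_card_preimset _ _ f); last by exists g => x _.
apply: eq_card => t; rewrite !inE /left_token; case: (f t) => i.
  by symmetry; apply/negbTE/imsetP=> -[].
by rewrite imset_f.
Qed.

(** Vertices of [X] are the tokens, named by vertices of [Y] through [g]; each is sent to the
    position where [p] has it, hence the inverse. *)
Definition arrangement (p : {perm Y}) : {ffun X -> Y} := [ffun x => p^-1 (g x)].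

Lemma arrangement_bijective p : bijectiveb (arrangement p).
Proof.
apply/andP; split.
  by apply/injectiveP=> x y; rewrite !ffunE => /perm_inj/(can_inj gK).
by apply/forallP=> y; apply/existsP; exists (f (p y)); rewrite ffunE fK permK.
Qed.

Definition FS_of_perm p : FS X Y :=
  exist (fun s => bijectiveb s) (arrangement p) (arrangement_bijective p).

Lemma FS_of_perm_surj (s : FS X Y) : exists p, s = FS_of_perm p.
Proof.
case: s => s sb; have /andP[/injectiveP s_inj _] := sb.
have inj : injective (fun t => s (f t)) by apply: inj_comp s_inj (can_inj fK).
by exists (perm inj)^-1; apply: val_inj; apply/ffunP=> x; rewrite ffunE invgK permE gK.
Qed.

Lemma FS_of_perm_step p q :
  swap_step (@edge Y) left_token p q -> edge (FS_of_perm p) (FS_of_perm q).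
Proof.
case/existsP=> x /existsP[y /and3P[xy cxy /eqP->]].
apply/existsP; exists (f (p x)); apply/existsP; exists (f (p y)).
have inv : (tperm x y * p)^-1 = p^-1 * tperm x y by rewrite invMg tpermV.
rewrite /= !ffunE !fK inv !permM !permK tpermL tpermR !eqxx xy /=.
apply/andP; split.
  by move: cxy; rewrite /left_token; case: (f (p x)) => ?; case: (f (p y)) => ?.
apply/forallP=> c; apply/implyP=> /andP[cx cy]; rewrite !ffunE inv permM tpermD //.
  by apply: contraNneq cx => ->; rewrite permKV gK.
by apply: contraNneq cy => ->; rewrite permKV gK.
Qed.

Lemma FS_connected : (forall p q, reach (@edge Y) left_token p q) -> connected (FS X Y).
Proof.
move=> all; split; first by apply/card_gt0P; exists (FS_of_perm 1).
move=> s t; have [p ->] := FS_of_perm_surj s; have [q ->] := FS_of_perm_surj t.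
have /connectP[c] := all p q; elim: c p => [|r c IHc] p /=; first by move=> _ ->.
by case/andP=> /FS_of_perm_step pr rc /(IHc _ rc); apply: connect_trans;
  apply: connect1.
Qed.
End Transfer.

Lemma eq_card_cancel (A B : finType) : #|A| = #|B| ->
  exists (f : A -> B) (g : B -> A), cancel f g /\ cancel g f.
Proof.
move=> AB; exists (fun a => enum_val (cast_ord AB (enum_rank a))).
exists (fun b => enum_val (cast_ord (esym AB) (enum_rank b))).
by split=> x; rewrite enum_valK ?cast_ordK ?cast_ordKV enum_rankK.
Qed.

Theorem theorem1p5 (n k : nat) (Y : sgraph)
    (hk : 6 <= 2 * k) (hn : 2 * k <= n) (hY : #|Y| = n)
    (hconn : vertex_connected (k - 1) Y)
    (hbip : ~ bipartite Y)
    (hcycle : ~ graph_iso Y (cycle_graph n)) :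
  connected (FS (complete_bipartite k (n - k)) Y).
Proof.
have k_gt2 : 2 < k by rewrite -(leq_pmul2l (isT : 0 < 2)).
have le_kk : k + k <= n by rewrite addnn -mul2n.
have le_kn : k <= n := leq_trans (leq_addr _ _) le_kk.
have le_knk : k <= n - k by rewrite -(leq_add2l k) subnKC.
have [_ delY] := hconn.
(* As [k] is at least 3, [(k - 1)]-connectivity allows the deletion of one vertex. *)
have linkS (S : {set Y}) : #|S| <= 1 ->
  {in ~: S &, forall x y, linked (@edge Y) (~: S) x y}.
  by move=> S1; apply/connected_linked/delY; rewrite (leq_ltn_trans S1) // ltn_subRL.
have conn : {in [set: Y] &, forall x y, linked (@edge Y) [set: Y] x y}.
  by have := linkS set0; rewrite cards0 setC0; apply.
have conn2 w : {in [set~ w] &, forall x y, linked (@edge Y) [set~ w] x y}.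
  by apply: linkS; rewrite cards1.
have /existsP[c0] : [exists c0 : Y, 2 < #|[set y | edge c0 y]|].
  apply: contra_notT hcycle; rewrite negb_exists => /forallP deg2.
  apply: max_degree2_cycle => //; first exact: leq_trans k_gt2 le_kn.
  by move=> x; rewrite leqNgt.
(* Exactly three neighbours are kept, so that [c0 |: A] is a claw with four vertices. *)
move=> /exists_set_of_card[A AN A3].
have nbr x : x \in A -> edge c0 x by move/(subsetP AN); rewrite inE.
have c0A : c0 \notin A by apply/negP=> /nbr; rewrite edge_irrefl.
have [|f [g [fK gK]]] := @eq_card_cancel Y (complete_bipartite k (n - k)).
  by rewrite card_sum !card_ord subnKC.
apply: (FS_connected fK gK) => p q.
apply: (all_reach (@edge_sym Y) (@edge_irrefl Y) conn conn2 (c0 := c0) (M :=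
  c0 |: A)) => //.
- exact: setU11.
- by rewrite cardsU1 c0A A3.
- by move=> x; rewrite !inE => /orP[/eqP->|/nbr//]; rewrite eqxx.
- by rewrite (card_left_token fK gK) ltnW.
by rewrite (card_right_token fK gK) (leq_trans k_gt2).
Qed.
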